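(* Let $p\geq 7$ be a prime number. Consider the left braces, up to isomorphism, with additive group $\mathbf{Z}_p\times(C_6\times C_2)$ and multiplicative group a semidirect product $\mathbf{Z}_p\rtimes\mathrm{Dic}_{12}$. 1) If $p\not\equiv 1\pmod 4$ there are 2 such braces. One of them is a direct product and the other one has a kernel of order 6. 2) If $p\equiv 1\pmod 4$ there are 3 such braces. One of them is a direct product, and the other two have kernels of order 6 and 3, respectively.
   Context: A left brace is a set $B$ with operations $+,\cdot$ such that $(B,+)$ is an abelian group (additive group), $(B,\cdot)$ is a group (multiplicative group), and $a(b+c)=ab-a+ac$ for all $a,b,c\in B$. Isomorphisms are bijections preserving both operations. $\mathbf{Z}_m=\mathbf{Z}/m\mathbf{Z}$, $C_m$ is the cyclic group of order $m$, and $\mathrm{Dic}_{12}=\langle x,y\mid x^3=1,y^4=1,yxy^{-1}=x^2\rangle$ is the dicyclic group of order 12. Given a left brace $B'$ of size 12 with multiplicative group $F$ and a group morphism $\tau:F\to\mathrm{Aut}(\mathbf{Z}_p)\simeq\mathbf{Z}_p^*$, the semidirect product of the trivial brace $\mathbf{Z}_p$ (with $a\cdot b=a+b$) and $B'$ via $\tau$ is $\mathbf{Z}_p\times B'$ with componentwise addition and $(a,b)\cdot(a',b')=(a+\tau(b)a',bb')$; it is the direct product of braces when $\tau$ is trivial. For $p\geq 7$ every left brace of size $12p$ is isomorphic to one of this form. The kernel of the brace means $\ker\tau\subseteq F$. ''Multiplicative group $\mathbf{Z}_p\rtimes F$'' means isomorphic to $\mathbf{Z}_p\rtimes_\tau F$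 for some $\tau$, possibly trivial. *)

(* Defs.v *)
From HB Require Import structures.
From mathcomp Require Import all_boot all_order all_fingroup all_algebra.
From mathcomp Require Import all_solvable.

Set Implicit Arguments.
Unset Strict Implicit.
Unset Printing Implicit Defensive.

Import GRing.Theory.

HB.mixin Record isLeftBrace B of GRing.Zmodule B & monoid.Group B := {
  mulg_addr : forall a b c : B,
    (a * (b + c)%R)%g = ((a * b)%g - a + (a * c)%g)%R
}.

#[short(type="leftBraceType")]
HB.structure Definition LeftBrace :=
  {B of GRing.Zmodule B & monoid.Group B & isLeftBrace B}.

(* The group structure of a finLeftBraceType is its multiplicative group: [set: B]
   and 'ker below refer to it, the additive group being reached through the
   zmodType structure only. *)
#[short(type="finLeftBraceType")]
HB.structure Definition FinLeftBrace := {B of LeftBrace B & Finite B}.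

Definition brace_iso (B1 B2 : leftBraceType) : Prop :=
  exists f : B1 -> B2,
    [/\ bijective f, {morph f : a b / (a + b)%R} & {morph f : a b / (a * b)%g}].

(* Z_p ><| gT for tau : gT -> Aut(Z_p), with Aut(Z_p) identified with the unit
   group of 'Z_p acting by multiplication. *)
Definition Zp_sdprod (p : nat) (gT : finGroupType)
  (tau : {morphism [set: gT] >-> {unit 'Z_p}}) : Type := ('Z_p * gT)%type.

Section SemidirectGroup.

Variables (p : nat) (gT : finGroupType).
Variable tau : {morphism [set: gT] >-> {unit 'Z_p}}.
Local Notation T := (Zp_sdprod tau).

HB.instance Definition _ := Finite.copy T ('Z_p * gT)%type.

Definition sdp_mul (u v : T) : T :=
  ((u.1 + val (tau u.2) * v.1)%R, (u.2 * v.2)%g).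
Definition sdp_one : T := (0%R, 1%g).
Definition sdp_inv (u : T) : T :=
  ((- (val (tau u.2^-1%g) * u.1))%R, u.2^-1%g).

Fact sdp_mulA : associative sdp_mul.
Proof.
move=> [a x] [b y] [c z]; rewrite /sdp_mul /= mulgA morphM ?inE //.
by rewrite mulrDr addrA FinRing.val_unitM mulrA.
Qed.

Fact sdp_mul1 : left_id sdp_one sdp_mul.
Proof.
by move=> [a x]; rewrite /sdp_mul /= morph1 FinRing.val_unit1 mul1r add0r mul1g.
Qed.

Fact sdp_mulV : left_inverse sdp_one sdp_inv sdp_mul.
Proof. by move=> [a x]; rewrite /sdp_mul /= addNr mulVg. Qed.

HB.instance Definition _ :=
  Finite_isGroup.Build T sdp_mulA sdp_mul1 sdp_mulV.

End SemidirectGroup.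

(* For a brace B, the semidirect product of the trivial brace Z_p and B. *)
Section SemidirectBrace.

Variables (p : nat) (B : finLeftBraceType).
Variable tau : {morphism [set: B] >-> {unit 'Z_p}}.
Local Notation T := (Zp_sdprod tau).

HB.instance Definition _ := GRing.Zmodule.copy T ('Z_p * B)%type.

Fact sdp_mul_addr (a b c : T) :
  (a * (b + c)%R)%g = ((a * b)%g - a + (a * c)%g)%R.
Proof.
case: a b c => [a x] [b y] [c z]; congr pair; rewrite /=.
  by rewrite mulrDr [(a + _ - a)%R]addrAC subrr add0r addrCA.
exact: mulg_addr.
Qed.

HB.instance Definition _ := isLeftBrace.Build T sdp_mul_addr.

End SemidirectBrace.

Definition is_Dic12 (gT : finGroupType) : Prop :=
  ([set: gT] \isog Grp (x : y : x ^+ 3, y ^+ 4, y * x * y^-1 = x ^+ 2))%g.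

Definition additive_group_ZpxC6xC2 (p : nat) (B : finLeftBraceType) : Prop :=
  exists f : {additive B -> ('Z_p * ('Z_6 * 'Z_2))%type}, bijective f.

Definition multiplicative_group_Zp_Dic12 (p : nat) (B : finLeftBraceType) :
  Prop :=
  exists (F : finGroupType) (tau : {morphism [set: F] >-> {unit 'Z_p}}),
    is_Dic12 F /\ [set: B] \isog [set: Zp_sdprod tau].

Definition sdprod_decomposition (p : nat) (B B' : finLeftBraceType)
    (tau : {morphism [set: B'] >-> {unit 'Z_p}}) : Prop :=
  #|B'| = 12 /\ brace_iso B (Zp_sdprod tau).

Definition is_direct_product (p : nat) (B : finLeftBraceType) : Prop :=
  exists (B' : finLeftBraceType) (tau : {morphism [set: B'] >-> {unit 'Z_p}}),
    (forall b : B', tau b = 1%g) /\ sdprod_decomposition B tau.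

(* The kernel is that of tau in a decomposition of B; the second clause makes its
   order independent of the decomposition chosen. *)
Definition has_kernel_of_order (p k : nat) (B : finLeftBraceType) : Prop :=
  (exists (B' : finLeftBraceType)
     (tau : {morphism [set: B'] >-> {unit 'Z_p}}), sdprod_decomposition B tau) /\
  (forall (B' : finLeftBraceType)
     (tau : {morphism [set: B'] >-> {unit 'Z_p}}),
     sdprod_decomposition B tau -> #|('ker tau)%g| = k).

(* There are exactly n braces satisfying P up to isomorphism, represented by the
   values of B. *)
Definition iso_representatives (P : finLeftBraceType -> Prop) (n : nat)
    (B : 'I_n -> finLeftBraceType) : Prop :=
  [/\ forall i, P (B i),
      forall i j, brace_iso (B i) (B j) -> i = j &
      forall B0 : finLeftBraceType, P B0 -> exists i, brace_iso B0 (B i)].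

(* Main.v *)
Require Import Defs.
From HB Require Import structures.
From mathcomp Require Import all_boot all_order all_fingroup all_algebra.
From mathcomp Require Import all_solvable.

(** Why the theorem holds.

    The basic tool is the lambda map of a left brace, lambda_a(b) = ab - a.  It
    is additive in b, multiplicative in a, and ab = a + lambda_a(b), so a brace
    is known once its additive group and lambda are known.  Every n-torsion
    subgroup T_n of the additive group is stable under lambda, hence is also a
    multiplicative subgroup.

    Let B have the prescribed additive and multiplicative groups.  The
    projection of Z_p ><| Dic12 gives a multiplicative morphism pi from B onto
    Dic12, and its kernel is T_p by counting.  So T_p is normal, and the
    elements outside T_p are controlled by pi, which is injective on T_2 and on
    T_3.  If u lies in T_n together with its conjugate by w, and w lies in T_k
    with k prime to n, then lambda_u fixes w (lam_coprime_fix): writing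
    u w = w u^w additively shows that lambda_u(w) - w is in both T_n and T_k.
    This and the structure of Dic12 determine lambda completely:
    - T_p acts trivially on T_12 because T_p is normal, and trivially on itself
      by Fermat's little theorem;
    - the group T_3 acts trivially on T_2 because T_3 T_p is the preimage of
      the normal Sylow 3-subgroup of Dic12;
    - Dic12 has a single involution, so some g in T_2 has k = g^2 <> 1; then
      T_2 = {0, g, k, g + k}, and lambda_g fixes k and swaps g with g + k;
    - an element of order 4 of Dic12 does not centralise the elements of order
      3, so lambda_g = -1 on T_3; then g m g^-1 = m^-1 for m in T_3, which
      forces T_3 to act trivially on T_p, where all actions commute;
    - lambda_g is multiplication by some t on T_p, and t^4 = 1 as g^4 = 1.
    Only t is free.  Writing z = m + k, with m of order 3, the triple made of a
    generator of T_p, of z and of g gives an isomorphism of B with an explicit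
    model dic_model t, the semidirect product of Z_p with the unique brace
    dicBrace on Z_6 x Z_2 whose multiplicative group is Dic12, through the
    character (a, b) |-> t^(2a + b) (dic_model_classification).

    It remains to count the models.  The kernel of the character has order
    12 / #[t].  The number of u such that u v = u + v for all v in T_p is an
    isomorphism invariant of a brace, and in any decomposition it is p times
    the order of the kernel (card_torsion_fixer); hence the kernel has the same
    order in all decompositions, and models with #[s] <> #[t] are not
    isomorphic.  Conversely, since the unit group of Z_p is cyclic, #[s] = #[t]
    with s^4 = t^4 = 1 gives t = s or t = s^-1, and the brace automorphism
    (a, b) |-> (a + 3b, b) of dicBrace exchanges these two characters
    (dic_model_iso).  So there is one brace for each divisor 2^i of 4 that
    divides p - 1, with kernel of order 12 / 2^i; i = 0 is the direct product,
    i = 1 always occurs, and i = 2 occurs exactly when p = 1 modulo 4. *)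

Set Implicit Arguments.
Unset Strict Implicit.
Unset Printing Implicit Defensive.

Import GroupScope GRing.Theory.

(** * Multiples in abelian groups *)

Lemma Z2P (P : 'Z_2 -> Prop) : P 0%R -> P 1%R -> forall b, P b.
Proof.
move=> P0 P1 [[|[|//]] Hb].
  by rewrite (_ : Ordinal _ = 0%R) //; apply: val_inj.
by rewrite (_ : Ordinal _ = 1%R) //; apply: val_inj.
Qed.

(** Isomorphisms of braces come as plain functions with morphism equations,
    without a declared additive structure, hence this form. *)
Lemma morph_mulrn (U V : zmodType) (f : U -> V) :
  {morph f : a b / (a + b)%R} -> forall n, {morph f : a / (a *+ n)%R}.
Proof.
move=> fD; have f0 : (f 0 = 0)%R by apply: (addrI (f 0)%R); rewrite -fD !addr0.
by elim=> // n IHn a; rewrite !mulrS fD IHn.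
Qed.

Lemma pair_mulrn (U V : zmodType) (u : U * V) n :
  (u *+ n = (u.1 *+ n, u.2 *+ n))%R.
Proof. by elim: n => [|n IHn] //; rewrite !mulrS IHn. Qed.

Lemma mulrn_card (B : finLeftBraceType) (b : B) : (b *+ #|B| = 0)%R.
Proof.
have : (\sum_(c : B) c = \sum_(c : B) (b + c))%R.
  by rewrite (reindex_inj (addrI b)).
by rewrite big_split /= sumr_const -{1}[(\sum_i i)%R]add0r => /addIr.
Qed.

Lemma mulrn_coprime (V : zmodType) (v : V) m n :
  coprime m n -> (v *+ m = 0 -> v *+ n = 0 -> v = 0)%R.
Proof.
case: n => [|n] co_mn vm vn.
  by rewrite /coprime gcdn0 in co_mn; rewrite -vm (eqP co_mn).
move: co_mn; rewrite coprime_sym => /(coprimeP _ (ltn0Sn n))[[a b] /= abE].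
have {}abE : (a * n.+1 = 1 + b * m)%N.
  by rewrite -abE subnK // ltnW // -subn_gt0 abE.
have: (v *+ (a * n.+1) = v *+ (1 + b * m))%R by rewrite abE.
rewrite mulrnDr ![(_ * n.+1)%N]mulnC ![(_ * m)%N]mulnC !mulrnA vm vn.
by rewrite !mul0rn addr0.
Qed.

Lemma mulrn_Zp p (a : 'Z_p) : 1 < p -> (a *+ p = 0)%R.
Proof. by move=> p1; rewrite -mulr_natr pchar_Zp ?mulr0. Qed.

(** When v is killed by m, the map i |-> v *+ i, with i : 'Z_m read as a natural
    number, is the additive map sending 1 to v.  The lemmas of this section let
    integer multiples be computed with residues. *)
Section MulrnZp.

Variables (V : zmodType) (m : nat) (v : V).
Hypotheses (m_gt1 : 1 < m) (vm : (v *+ m = 0)%R).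

Lemma mulrn_mod n : (v *+ (n %% m) = v *+ n)%R.
Proof.
by rewrite [in RHS](divn_eq n m) mulrnDr mulnC mulrnA vm mul0rn add0r.
Qed.

Lemma mulrn_ZpD (i j : 'Z_m) : (v *+ (i + j)%R = v *+ i + v *+ j)%R.
Proof. by rewrite -mulrnDr -[RHS]mulrn_mod /= [X in (_ %% X)%N]Zp_cast. Qed.

Lemma mulrn_ZpM (i j : 'Z_m) : (v *+ (i * j)%R = v *+ i *+ j)%R.
Proof. by rewrite -mulrnA -[RHS]mulrn_mod /= [X in (_ %% X)%N]Zp_cast. Qed.

Lemma mulrn_Zp_nat n : (v *+ (n%:R : 'Z_m)%R = v *+ n)%R.
Proof. by rewrite val_Zp_nat // mulrn_mod. Qed.

End MulrnZp.

(** * The lambda map of a left brace *)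

Lemma brace1E (B : leftBraceType) : 1 = 0%R :> B.
Proof.
have /eqP := @mulg_addr B 1 0%R 0%R.
by rewrite !(addr0, mul1g) sub0r eq_sym oppr_eq0 => /eqP.
Qed.

Section Lambda.

Variable B : leftBraceType.
Implicit Types a b c : B.

Definition lam a b : B := ((a * b)%g - a)%R.

Lemma mulgE_lam a b : a * b = (a + lam a b)%R.
Proof. by rewrite addrC subrK. Qed.

Lemma lamD a : {morph lam a : b c / (b + c)%R}.
Proof. by move=> b c; rewrite /lam mulg_addr addrA. Qed.

Lemma lam0 a : lam a 0%R = 0%R.
Proof. by rewrite /lam -{1}(brace1E B) mulg1 subrr. Qed.

Lemma lamN a : {morph lam a : b / (- b)%R}.
Proof. by move=> b; apply: (addrI (lam a b)); rewrite -lamD !subrr lam0. Qed.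

Lemma lamMn a n : {morph lam a : b / (b *+ n)%R}.
Proof. exact/morph_mulrn/lamD. Qed.

Lemma lam1 b : lam 1 b = b.
Proof. by rewrite /lam mul1g (brace1E B) subr0. Qed.

Lemma lamM a b c : lam (a * b) c = lam a (lam b c).
Proof. by rewrite [lam b c]/lam lamD lamN /lam opprB addrA subrK mulgA. Qed.

Lemma lam_inj a : injective (lam a).
Proof. by move=> b c /addIr/mulgI. Qed.

Lemma lam_fix_mul a b : lam a b = b -> a * b = (a + b)%R.
Proof. by rewrite mulgE_lam => ->. Qed.

Lemma lam_fixX a b n : lam a b = b -> lam (a ^+ n) b = b.
Proof. by move=> ab; elim: n => [|n IHn]; rewrite ?lam1 // expgS lamM IHn. Qed.

(** Used for actions on a cyclic group, where each lambda is a scaling. *)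
Lemma lam_scaleX a b s n :
  lam a b = (b *+ s)%R -> lam (a ^+ n) b = (b *+ (s ^ n)%N)%R.
Proof.
move=> ab; elim: n => [|n IHn]; first by rewrite lam1.
by rewrite expgS lamM IHn lamMn ab -mulrnA -expnS.
Qed.

Lemma lam_selfX a n : lam a a = a -> a ^+ n = (a *+ n)%R.
Proof.
move=> aa; elim: n => [|n IHn]; first exact: brace1E.
by rewrite expgS mulrS IHn lam_fix_mul // lamMn aa.
Qed.

End Lambda.

(** * Torsion subgroups as left ideals *)

Section Torsion.

Variable B : finLeftBraceType.
Implicit Types (a b u w : B) (n k : nat).

Definition torsion n : {set B} := [set b | (b *+ n == 0)%R].

Lemma torsionP n b : reflect (b *+ n = 0)%R (b \in torsion n).
Proof. by rewrite inE; apply: eqP. Qed.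

Lemma lam_torsion n a b : b \in torsion n -> lam a b \in torsion n.
Proof. by move=> /torsionP nb; apply/torsionP; rewrite -lamMn nb lam0. Qed.

Lemma torsionD n a b :
  a \in torsion n -> b \in torsion n -> (a + b)%R \in torsion n.
Proof.
move=> /torsionP na /torsionP nb; apply/torsionP.
by rewrite mulrnDl na nb addr0.
Qed.

Lemma torsionN n a : a \in torsion n -> (- a)%R \in torsion n.
Proof. by move=> /torsionP na; apply/torsionP; rewrite mulNrn na oppr0. Qed.

Lemma torsion_mulrn n k a : a \in torsion n -> (a *+ k)%R \in torsion n.
Proof. by move=> /torsionP na; apply/torsionP; rewrite mulrnAC na mul0rn. Qed.

Lemma torsion_dvd n k : n %| k -> torsion n \subset torsion k.
Proof.
case/dvdnP=> q ->; apply/subsetP=> b /torsionP nb.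
by apply/torsionP; rewrite mulnC mulrnA nb mul0rn.
Qed.

Fact torsion_group_set n : group_set (torsion n).
Proof.
apply/group_setP; split; first by apply/torsionP; rewrite (brace1E B) mul0rn.
by move=> a b na nb; rewrite mulgE_lam torsionD // lam_torsion.
Qed.

Canonical torsion_group n := Group (torsion_group_set n).

Lemma torsion_coprime n k b :
  coprime n k -> b \in torsion n -> b \in torsion k -> b = 0%R.
Proof.
by move=> co_nk /torsionP nb /torsionP kb; apply: mulrn_coprime co_nk nb kb.
Qed.

Lemma torsion_expg_card n b : b \in torsion n -> b ^+ #|torsion n| = 1.
Proof. exact: expg_cardG. Qed.

(** The product u w = w (u ^ w) reads u + lambda_u(w) = w + lambda_w(u ^ w), so
    that lambda_u(w) - w = lambda_w(u ^ w) - u: the left side is in T_k and the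
    right side is in T_n. *)
Lemma lam_coprime_fix n k u w :
  coprime n k -> u \in torsion n -> u ^ w \in torsion n ->
  w \in torsion k -> lam u w = w.
Proof.
move=> co_nk nu nuw kw; apply/eqP; rewrite -subr_eq0; apply/eqP.
have eq_uw : (lam u w - w = lam w (u ^ w)%g - u)%R.
  apply: (addrI u); rewrite [RHS]addrCA subrr addr0 addrA -mulgE_lam conjgC.
  by rewrite mulgE_lam addrAC subrr add0r.
apply: (torsion_coprime co_nk).
  by rewrite eq_uw torsionD ?torsionN ?lam_torsion.
by rewrite torsionD ?torsionN ?lam_torsion.
Qed.

End Torsion.

(** * Isomorphisms of semidirect products and the order of the kernel *)

Lemma brace_iso_refl (B : leftBraceType) : brace_iso B B.
Proof. by exists id; split=> //; exists id. Qed.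

Lemma brace_iso_sym (B1 B2 : leftBraceType) :
  brace_iso B1 B2 -> brace_iso B2 B1.
Proof.
case=> f [[g fK gK] fD fM]; exists g; split; first by exists f.
  by move=> a b; rewrite -{1}[a]gK -{1}[b]gK -fD fK.
by move=> a b; rewrite -{1}[a]gK -{1}[b]gK -fM fK.
Qed.

Lemma brace_iso_trans (B1 B2 B3 : leftBraceType) :
  brace_iso B1 B2 -> brace_iso B2 B3 -> brace_iso B1 B3.
Proof.
case=> f [bij_f fD fM] [g [bij_g gD gM]]; exists (g \o f).
split; first exact: bij_comp.
  by move=> a b; rewrite /= fD gD.
by move=> a b; rewrite /= fM gM.
Qed.

(** The elements acting trivially through lambda on the n-torsion.  Being
    defined from the brace operations alone, this set has a cardinal that does
    not depend on a decomposition of the brace. *)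
Definition torsion_fixer n (B : finLeftBraceType) : {set B} :=
  [set u | [forall v : B, (v *+ n == 0)%R ==> (u * v == (u + v)%R)]].

Lemma torsion_fixerP n (B : finLeftBraceType) (u : B) :
  reflect (forall v : B, (v *+ n = 0)%R -> u * v = (u + v)%R)
          (u \in torsion_fixer n B).
Proof.
rewrite inE; apply: (iffP forallP) => uP v; last by apply/implyP=> /eqP/uP/eqP.
by move/eqP=> nv; apply/eqP; apply: (implyP (uP v)).
Qed.

Lemma brace_iso_torsion_fixer n (B1 B2 : finLeftBraceType) :
  brace_iso B1 B2 -> #|torsion_fixer n B1| = #|torsion_fixer n B2|.
Proof.
case=> f [bij_f fD fM]; have inj_f := bij_inj bij_f.
have f0 : f 0%R = 0%R by apply: (addrI (f 0%R)); rewrite -fD !addr0.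
have [g fK gK] := bij_f.
rewrite -(card_imset _ inj_f); congr #|pred_of_set _|; apply/setP=> u.
rewrite -[u]gK (mem_imset _ _ inj_f).
apply/torsion_fixerP/torsion_fixerP=> uP v nv.
  rewrite -[v]gK -fM -fD uP //; apply: inj_f.
  by rewrite (morph_mulrn fD) gK nv f0.
by apply: inj_f; rewrite fM fD uP // -(morph_mulrn fD) nv f0.
Qed.

(** As p is prime to #|B|, the p-torsion of the semidirect product is Z_p x 0,
    on which (a, b) acts as multiplication by tau b. *)
Lemma card_torsion_fixer p (B : finLeftBraceType)
    (tau : {morphism [set: B] >-> {unit 'Z_p}}) :
  1 < p -> coprime p #|B| ->
  #|torsion_fixer p (Zp_sdprod tau)| = (p * #|'ker tau|)%N.
Proof.
move=> p_gt1 co_pB.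
have -> : torsion_fixer p (Zp_sdprod tau) = setX [set: 'Z_p] ('ker tau).
  apply/setP=> -[a b]; rewrite in_setX in_setT /=.
  apply/torsion_fixerP/(kerP tau (in_setT b)) => [/(_ (1%R, 0%R)) | tb [c d]].
    rewrite pair_mulrn /= mulrn_Zp // mul0rn => /(_ erefl) /(congr1 fst).
    by move/addrI; rewrite mulr1 => tb; apply: val_inj.
  rewrite pair_mulrn /= => -[_ dp].
  rewrite (mulrn_coprime co_pB dp (mulrn_card d)).
  congr pair; first by rewrite /= tb mul1r.
  by rewrite /= addr0 -(brace1E B) mulg1.
by rewrite cardsX cardsT card_ord Zp_cast.
Qed.

(** The order of the kernel is read off the number of elements of
    torsion_fixer, which is the same for all decompositions. *)
Lemma has_kernel_sdprod p (B : finLeftBraceType)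
    (tau : {morphism [set: B] >-> {unit 'Z_p}}) :
  1 < p -> coprime p 12 -> #|B| = 12 ->
  has_kernel_of_order p #|'ker tau| (Zp_sdprod tau).
Proof.
move=> p_gt1 co_p12 cB; split.
  by exists B, tau; split=> //; apply: brace_iso_refl.
move=> B' tau' [cB' /(brace_iso_torsion_fixer p)].
rewrite !card_torsion_fixer ?cB ?cB' // => /eqP.
by rewrite eqn_pmul2l ?(ltnW p_gt1) // eq_sym => /eqP.
Qed.

(** Precomposing the character with an isomorphism of braces does not change
    the semidirect product up to isomorphism. *)
Lemma brace_iso_sdprod p (B1 B2 : finLeftBraceType)
    (tau1 : {morphism [set: B1] >-> {unit 'Z_p}})
    (tau2 : {morphism [set: B2] >-> {unit 'Z_p}}) (f : B1 -> B2) :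
  bijective f -> {morph f : a b / (a + b)%R} -> {morph f : a b / a * b} ->
  (forall b, tau2 (f b) = tau1 b) ->
  brace_iso (Zp_sdprod tau1) (Zp_sdprod tau2).
Proof.
case=> g fK gK fD fM tauf; exists (fun u => (u.1, f u.2)); split.
- by exists (fun u => (u.1, g u.2)) => -[a b] /=; rewrite ?fK ?gK.
- by move=> [a b] [c d]; congr pair; apply: fD.
by move=> [a b] [c d]; congr pair; rewrite /= ?tauf //; apply: fM.
Qed.

(** * The brace of order 12 with multiplicative group Dic12 *)

(** On Z_6 x Z_2 let lambda_(a, b) be the b-th power of the involution
    (c, d) |-> (- c + 3 d, d): this is minus one on the 3-torsion and a
    transvection of the 2-torsion.  The resulting brace has multiplicative
    group Dic12. *)
Definition dicBrace : Type := ('Z_6 * 'Z_2)%type.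

HB.instance Definition _ := Finite.copy dicBrace ('Z_6 * 'Z_2)%type.
HB.instance Definition _ := GRing.Zmodule.copy dicBrace ('Z_6 * 'Z_2)%type.

(** An explicit enumeration: unlike enum, it computes, so that statements
    quantified over dicBrace can be decided by evaluation. *)
Definition dic_seq : seq dicBrace :=
  [seq (inZp a, inZp b) | a <- iota 0 6, b <- iota 0 2].

Lemma dic_allP (P : pred dicBrace) : all P dic_seq -> forall q, P q.
Proof.
move/allP=> allP [a b]; apply: allP.
have -> : (a, b) = (inZp (nat_of_ord a), inZp (nat_of_ord b)) :> dicBrace.
  by rewrite !valZpK.
by apply: allpairs_f; rewrite mem_iota ltn_ord.
Qed.

Definition dic_mul (u v : dicBrace) : dicBrace :=
  ((u.1 + (-1) ^+ u.2 * v.1 + (3 * (u.2 * v.2))%:R)%R, (u.2 + v.2)%R).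

Definition dic_inv (u : dicBrace) : dicBrace :=
  (((-1) ^+ u.2 * ((3 * u.2)%:R - u.1))%R, (- u.2)%R).

Fact dic_mulA : associative dic_mul.
Proof.
move=> u v w; apply/eqP; move: w; apply: dic_allP.
by move: v; apply: dic_allP; move: u; apply: dic_allP; vm_compute.
Qed.

Fact dic_mul1 : left_id (0%R : dicBrace) dic_mul.
Proof. by move=> u; apply/eqP; move: u; apply: dic_allP; vm_compute. Qed.

Fact dic_mulV : left_inverse (0%R : dicBrace) dic_inv dic_mul.
Proof. by move=> u; apply/eqP; move: u; apply: dic_allP; vm_compute. Qed.

HB.instance Definition _ :=
  Finite_isGroup.Build dicBrace dic_mulA dic_mul1 dic_mulV.

Fact dic_mul_addr (a b c : dicBrace) :
  (a * (b + c)%R)%g = ((a * b)%g - a + (a * c)%g)%R.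
Proof.
apply/eqP; move: c; apply: dic_allP.
by move: b; apply: dic_allP; move: a; apply: dic_allP; vm_compute.
Qed.

HB.instance Definition _ := isLeftBrace.Build dicBrace dic_mul_addr.

Lemma card_dicBrace : #|{: dicBrace}| = 12.
Proof. by rewrite card_prod !card_ord. Qed.

(** The generators x and y of the presentation of Dic12; y^2 = (3, 0) is the
    central involution. *)
Definition dic_x : dicBrace := (2%:R, 0)%R.
Definition dic_y : dicBrace := (0, 1)%R.

Lemma dic_expE (q : dicBrace) :
  q = dic_x ^+ (2 * q.1) * dic_y ^+ (2 * q.1 + q.2).
Proof. by apply/eqP; move: q; apply: dic_allP; vm_compute. Qed.

Lemma dic_gen : <[dic_x]> <*> <[dic_y]> = [set: dicBrace].
Proof.
apply/eqP; rewrite eqEsubset subsetT /=; apply/subsetP => q _.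
by rewrite [q]dic_expE groupM // groupX // mem_gen // inE cycle_id ?orbT.
Qed.

Lemma dic_rels :
  [/\ dic_x ^+ 3 = 1, dic_y ^+ 4 = 1 & dic_y * dic_x * dic_y^-1 = dic_x ^+ 2].
Proof. by split; apply/eqP; vm_compute. Qed.

(** Any pair satisfying the relations of Dic12 extends to a morphism from
    dicBrace: the normal form dic_expE dictates its values. *)
Section MorphismFromDic12.

Variables (gT : finGroupType) (x y : gT).
Hypotheses (x3 : x ^+ 3 = 1) (y4 : y ^+ 4 = 1) (yx : y * x * y^-1 = x ^+ 2).

Definition dic_morph (q : dicBrace) := x ^+ (2 * q.1) * y ^+ (2 * q.1 + q.2).

(** Moving y^b across x^c only depends on the parity of b, which brings the
    product of two normal forms to x^i y^j; what is left is a congruence between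
    exponents, modulo 3 for x and modulo 4 for y. *)
Lemma dic_morphM : {morph dic_morph : u v / u * v}.
Proof.
have yx2 c : y * x ^+ c = x ^+ (c * 2) * y.
  by rewrite conjgCV conjXg mulnC expgM -yx conjgE invgK mulgA.
have yX b c : y ^+ b * x ^+ c = x ^+ (c * (odd b).+1) * y ^+ b.
  elim: b => [|b IH]; first by rewrite mulg1 mul1g muln1.
  rewrite !expgS -mulgA IH mulgA yx2 -!mulgA; congr (_ * _).
  rewrite -mulnA /=; case: (odd b) => //=.
  rewrite (_ : 2 * 2 = 1 + 3)%N // mulnDr expgD [(c * 3)%N]mulnC.
  by rewrite [x ^+ (3 * c)]expgM x3 expg1n mulg1.
move=> u v; rewrite /dic_morph mulgA -[x ^+ _ * _ * _]mulgA yX mulgA.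
rewrite -expgD -mulgA -expgD.
have /andP[/eqP ex /eqP ey]:
    (2 * (u * v)%g.1
       == 2 * u.1 + 2 * v.1 * (odd (2 * u.1 + u.2)).+1 %[mod 3]) &&
    (2 * (u * v)%g.1 + (u * v)%g.2
       == 2 * u.1 + u.2 + (2 * v.1 + v.2) %[mod 4])%N.
  by move: v; apply: dic_allP; move: u; apply: dic_allP; vm_compute.
congr (_ * _); first by rewrite -(expg_mod _ x3) ex (expg_mod _ x3).
by rewrite -(expg_mod _ y4) ey (expg_mod _ y4).
Qed.

End MorphismFromDic12.

Lemma dic_is_Dic12 : is_Dic12 dicBrace.
Proof.
have homD : [set: dicBrace] \homg
    Grp (x : y : x ^+ 3, y ^+ 4, y * x * y^-1 = x ^+ 2).
  apply/existsP; exists (dic_x, dic_y); rewrite /= !xpair_eqE.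
  case: dic_rels => /eqP ? /eqP ? /eqP ?; apply/and4P; split=> //.
  exact/eqP/dic_gen.
move=> rT H; apply/idP/idP => [homH | ]; first exact: homGrp_trans homD.
case/existsP=> -[x y] /= /eqP[defH x3 y4 yx].
have fM : {in [set: dicBrace] &, {morph dic_morph x y : u v / u * v}}.
  by move=> u v _ _; apply: dic_morphM.
pose f := Morphism fM; apply/homgP; exists f.
have fx : f dic_x = x by rewrite /= /dic_morph /= y4 mulg1 (expgS x 3) x3 mulg1.
have fy : f dic_y = y by rewrite /= /dic_morph /= mul1g expg1.
rewrite -[X in f @* X]dic_gen morphimY ?subsetT // !morphim_cycle ?inE //.
by rewrite fx fy.
Qed.

Lemma card_dic_pred (P : pred dicBrace) : #|[set q | P q]| = count P dic_seq.
Proof.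
rewrite cardE -size_filter; apply: perm_size; apply: uniq_perm.
- exact: enum_uniq.
- by apply: filter_uniq; vm_compute.
move=> q; rewrite mem_enum inE mem_filter.
by rewrite (_ : q \in dic_seq) ?andbT //; move: q; apply: dic_allP; vm_compute.
Qed.

(** The brace automorphism that exchanges (0, 1) and (3, 1), the two generators
    of the multiplicative group of the 2-torsion, which is cyclic of order 4. *)
Definition dic_swap (q : dicBrace) : dicBrace := ((q.1 + (3 * q.2)%:R)%R, q.2).

Lemma dic_swapK : involutive dic_swap.
Proof. by move=> q; apply/eqP; move: q; apply: dic_allP; vm_compute. Qed.

Lemma dic_swapD : {morph dic_swap : u v / (u + v)%R}.
Proof.
move=> u v; apply/eqP; move: v; apply: dic_allP.
by move: u; apply: dic_allP; vm_compute.
Qed.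

Lemma dic_swapM : {morph dic_swap : u v / u * v}.
Proof.
move=> u v; apply/eqP; move: v; apply: dic_allP.
by move: u; apply: dic_allP; vm_compute.
Qed.

Lemma dic_involution (q : dicBrace) : q ^+ 2 = 1 -> q != 1 -> q = (3%:R, 0)%R.
Proof.
have E : (q ^+ 2 == 1) ==> (q != 1) ==> (q == (3%:R, 0)%R).
  by move: q; apply: dic_allP; vm_compute.
by move=> /eqP q2 q1; move: E; rewrite q2 q1 => /eqP.
Qed.

Lemma dic_conj3 (q r : dicBrace) : q ^+ 3 = 1 -> q ^ r = q \/ q ^ r = q ^+ 2.
Proof.
have E : (q ^+ 3 == 1) ==> ((q ^ r == q) || (q ^ r == q ^+ 2)).
  by move: r; apply: dic_allP; move: q; apply: dic_allP; vm_compute.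
by move=> /eqP q3; move: E; rewrite q3 => /orP[] /eqP; [left | right].
Qed.

(** Elements of order 4 do not centralise the elements of order 3. *)
Lemma dic_no_commute (q r : dicBrace) :
  q ^+ 2 != 1 -> q ^+ 4 = 1 -> r ^+ 3 = 1 -> q * r = r * q -> r = 1.
Proof.
have E : [&& q ^+ 2 != 1, q ^+ 4 == 1, r ^+ 3 == 1 & q * r == r * q] ==>
    (r == 1).
  by move: r; apply: dic_allP; move: q; apply: dic_allP; vm_compute.
by move=> q2 /eqP q4 /eqP r3 /eqP qr; move: E; rewrite q2 q4 r3 qr => /eqP.
Qed.

Lemma dic_add2 (a b c : dicBrace) :
  (a *+ 2 = 0 -> b *+ 2 = 0 -> c *+ 2 = 0 -> a != 0 -> b != 0 -> a != b ->
  c \in [:: 0; a; b; a + b])%R.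
Proof.
have E : ([&& a *+ 2 == 0, b *+ 2 == 0, c *+ 2 == 0, a != 0, b != 0 & a != b]
    ==> (c \in [:: 0; a; b; a + b]))%R.
  move: c; apply: dic_allP; move: b; apply: dic_allP.
  by move: a; apply: dic_allP; vm_compute.
move=> /eqP a2 /eqP b2 /eqP c2 a0 b0 ab.
by move: E; rewrite a2 b2 c2 a0 b0 ab.
Qed.

Lemma dic_add3 (a b : dicBrace) :
  (a *+ 3 = 0 -> b *+ 3 = 0 -> a != 0 -> b \in [:: 0; a; - a])%R.
Proof.
have E : ([&& a *+ 3 == 0, b *+ 3 == 0 & a != 0] ==> (b \in [:: 0; a; - a]))%R.
  by move: b; apply: dic_allP; move: a; apply: dic_allP; vm_compute.
by move=> /eqP a3 /eqP b3 a0; move: E; rewrite a3 b3 a0.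
Qed.

(** * The model braces of order 12p *)

Section DicModel.

Variables (p : nat) (t : {unit 'Z_p}).
Hypothesis t4 : t ^+ 4 = 1.

Fact dic_charM : {in [set: dicBrace] &, {morph dic_morph 1 t : u v / u * v}}.
Proof.
move=> u v _ _; apply: dic_morphM => //; first exact: expg1n.
by rewrite mulg1 mulgV expg1n.
Qed.

(** The generator x of order 3 is sent to 1, as in any abelian quotient of
    Dic12, and y to t; thus (a, b) is sent to t^(2a + b). *)
Definition dic_char : {morphism [set: dicBrace] >-> {unit 'Z_p}} :=
  Morphism dic_charM.

Definition dic_model : finLeftBraceType := Zp_sdprod dic_char.

Lemma dic_charE q : dic_char q = t ^+ (2 * q.1 + q.2).
Proof. by rewrite /= /dic_morph expg1n mul1g. Qed.

(** The image of the character is generated by t. *)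
Lemma card_ker_dic_char : (#|'ker dic_char| * #[t])%N = 12.
Proof.
have im_t: dic_char @* [set: dicBrace] = <[t]>.
  rewrite -[X in dic_char @* X]dic_gen morphimY ?subsetT //.
  rewrite !morphim_cycle ?inE //.
  have -> : dic_char dic_x = 1 by rewrite dic_charE -[RHS]t4.
  have -> : dic_char dic_y = t by rewrite dic_charE -[RHS]expg1.
  by rewrite cycle1 joing1G.
rewrite /order -im_t card_morphim setTI Lagrange ?subsetT // cardsT.
exact: card_dicBrace.
Qed.

Definition dic_model_coord (u : dic_model) : 'Z_p * ('Z_6 * 'Z_2) := u.

HB.instance Definition _ := GRing.isZmodMorphism.Build dic_model _
  dic_model_coord (fun _ _ => erefl).

Lemma dic_model_additive : additive_group_ZpxC6xC2 p dic_model.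
Proof. by exists dic_model_coord; exists id. Qed.

Lemma dic_model_multiplicative : multiplicative_group_Zp_Dic12 p dic_model.
Proof.
by exists dicBrace, dic_char; split; [exact: dic_is_Dic12 | exact: isog_refl].
Qed.

Lemma dic_model_kernel : 1 < p -> coprime p 12 ->
  has_kernel_of_order p (12 %/ #[t]) dic_model.
Proof.
move=> p_gt1 co_p; rewrite -card_ker_dic_char mulnK //.
exact: has_kernel_sdprod card_dicBrace.
Qed.

Lemma card_torsion_fixer_dic_model : 1 < p -> coprime p 12 ->
  (#|torsion_fixer p dic_model| * #[t] = p * 12)%N.
Proof.
move=> p_gt1 co_p; rewrite -card_ker_dic_char mulnA.
by congr (_ * _)%N; apply: card_torsion_fixer; rewrite ?[#|_|]card_dicBrace.
Qed.

End DicModel.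

Lemma dic_model_direct p (t4 : (1 : {unit 'Z_p}) ^+ 4 = 1) :
  is_direct_product p (dic_model t4).
Proof.
exists dicBrace, (dic_char t4).
split; first by move=> b; rewrite dic_charE expg1n.
by split; [exact: card_dicBrace | exact: brace_iso_refl].
Qed.

(** An isomorphism preserves the order of torsion_fixer, which is
    12 p / #[t].  Conversely, s and t generate the same subgroup of the cyclic
    group of units, so that t is an odd power of s (an even power has the same
    order as s only when both are 1): either t = s, or t = s^3 = s^-1 and
    dic_swap carries one character to the other. *)
Lemma dic_model_iso p (s t : {unit 'Z_p}) (s4 : s ^+ 4 = 1) (t4 : t ^+ 4 = 1) :
  prime p -> coprime p 12 ->
  brace_iso (dic_model s4) (dic_model t4) <-> #[s] = #[t].
Proof.
move=> p_pr co_p; have p_gt1 := prime_gt1 p_pr; split.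
  move/(brace_iso_torsion_fixer p) => eq_fix; apply/eqP.
  have fix_s := card_torsion_fixer_dic_model s4 p_gt1 co_p.
  have fix_gt0 : 0 < #|torsion_fixer p (dic_model s4)|.
    rewrite lt0n; apply: contra_eq_neq fix_s => ->.
    by rewrite mul0n eq_sym muln_eq0 orbF -lt0n ltnW.
  rewrite -(eqn_pmul2l fix_gt0) fix_s eq_fix.
  by rewrite (card_torsion_fixer_dic_model t4 p_gt1 co_p).
move=> eq_st.
have /cycleP[i def_t] : t \in <[s]>.
  suff /eqP-> : <[s]> :==: <[t]> by apply: cycle_id.
  by rewrite (eq_subG_cyclic (units_Zp_cyclic p_pr)) ?subsetT //; apply/eqP.
have iso_id : s = t -> brace_iso (dic_model s4) (dic_model t4).
  move=> eq_s_t; apply: (brace_iso_sdprod (f := id)) => // [|b].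
    by exists id.
  by rewrite !dic_charE eq_s_t.
have {}def_t : t = s ^+ (i %% 4) by rewrite expg_mod.
have: i %% 4 < 4 by rewrite ltn_pmod.
case odd_i: (odd (i %% 4)); last first.
  move=> _; apply: iso_id.
  have t2 : t ^+ 2 = 1.
    rewrite def_t -expgM -[(_ %% 4)%N]odd_double_half odd_i add0n.
    by rewrite -muln2 -mulnA mulnC expgM s4 expg1n.
  have s2 : s ^+ 2 = 1 by apply/eqP; rewrite -order_dvdn eq_st order_dvdn t2.
  have t1 : t = 1.
    rewrite def_t -[(_ %% 4)%N]odd_double_half odd_i add0n.
    by rewrite -mul2n expgM s2 expg1n.
  by apply/eqP; rewrite t1 -order_eq1 eq_st t1 order1.
case: (i %% 4) def_t odd_i => [|[|[|[|//]]]] // def_t _ _; first exact: iso_id.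
apply: (brace_iso_sdprod (f := dic_swap)).
- by exists dic_swap; apply: dic_swapK.
- exact: dic_swapD.
- exact: dic_swapM.
move=> q; rewrite !dic_charE def_t -expgM.
rewrite -(expg_mod _ s4) -[RHS](expg_mod _ s4).
by congr (s ^+ _); apply/eqP; move: q; apply: dic_allP; vm_compute.
Qed.

(** * Recognising a model brace from generators *)

(** Since lambda is multiplicative, its values on e, z and g determine the
    product of any two sums of multiples of e, z and g.  The hypotheses below
    say that lambda_e, lambda_z and lambda_g take on these elements the values
    of the model: g stands for (0, 1), z for (1, 0), and g^2 = 3z. *)
Section Recognition.

Variables (p s : nat) (t : {unit 'Z_p}) (t4 : t ^+ 4 = 1).
Variables (B : finLeftBraceType) (e z g : B).
Hypotheses (p_gt1 : 1 < p) (t_s : val t = (s%:R)%R).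
Hypotheses (pe : (e *+ p = 0)%R) (z6 : (z *+ 6 = 0)%R) (g2 : (g *+ 2 = 0)%R).
Hypotheses (ee : lam e e = e) (ez : lam e z = z) (eg : lam e g = g).
Hypotheses (ze : lam z e = (e *+ (s ^ 2)%N)%R).
Hypotheses (zz : lam z z = z) (zg : lam z g = g).
Hypotheses (ge : lam g e = (e *+ s)%R) (gz : lam g z = (- z)%R).
Hypothesis gg : lam g g = (g + z *+ 3)%R.

Definition dic_recog (u : dic_model t4) : B :=
  (e *+ u.1 + (z *+ u.2.1 + g *+ u.2.2))%R.

Lemma dic_recogD : {morph dic_recog : u v / (u + v)%R}.
Proof.
move=> [x [a b]] [y [c d]]; rewrite /dic_recog /=.
rewrite (mulrn_ZpD p_gt1 pe) (mulrn_ZpD _ z6) // (mulrn_ZpD _ g2) //.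
by rewrite [RHS]addrACA; congr (_ + _)%R; apply: addrACA.
Qed.

(** The elements e, z and g are added in such an order that each one fixes the
    following ones under lambda, so that sums are also products. *)
Lemma dic_recog_mulE u :
  dic_recog u = e ^+ u.1 * (z ^+ u.2.1 * g ^+ u.2.2).
Proof.
case: u => [x [a b]]; rewrite /dic_recog /=.
have -> : g ^+ b = (g *+ b)%R.
  by elim/Z2P: b; rewrite ?expg1 // ; apply: brace1E.
rewrite (lam_fix_mul (b := (g *+ b)%R)); last by rewrite lamMn lam_fixX.
rewrite (lam_selfX a zz) lam_fix_mul ?(lam_selfX x ee) //.
by rewrite lamD !lamMn -(lam_selfX x ee) !lam_fixX.
Qed.

Lemma dic_recogM : {morph dic_recog : u v / u * v}.
Proof.
move=> u v; rewrite [RHS]mulgE_lam {2}(dic_recog_mulE u).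
case: u v => [x [a b]] [y [c d]].
have [Ee Ez Eg] :
    [/\ lam (e ^+ x) e = e, lam (e ^+ x) z = z & lam (e ^+ x) g = g].
  by split; apply: lam_fixX.
have [Zz Zg] : lam (z ^+ a) z = z /\ lam (z ^+ a) g = g.
  by split; apply: lam_fixX.
have lame : lam (e ^+ x * (z ^+ a * g ^+ b)) e = (e *+ (s ^ (2 * a + b))%N)%R.
  rewrite !lamM (lam_scaleX _ ge) !lamMn (lam_scaleX _ ze) lamMn Ee.
  by rewrite -mulrnA expnD expnM.
have lamz : lam (e ^+ x * (z ^+ a * g ^+ b)) z = (z *+ ((-1) ^+ b : 'Z_6)%R)%R.
  rewrite !lamM; elim/Z2P: b {lame}; first by rewrite lam1 Zz Ez.
  rewrite expg1 gz !lamN Zz Ez; apply: (addIr z).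
  by rewrite addNr -[LHS]z6 mulrSr.
have lamg : lam (e ^+ x * (z ^+ a * g ^+ b)) g = (g + z *+ (3 * b))%R.
  rewrite !lamM; elim/Z2P: b {lame lamz} => /=.
    by rewrite lam1 Zg Eg muln0 addr0.
  by rewrite expg1 gg (lamD (_ ^+ _) g) lamMn Zz Zg (lamD _ g) lamMn Ez Eg.
rewrite [LHS](_ : _ = e *+ (x + val (t ^+ (2 * a + b))%g * y : 'Z_p)%R
    + (z *+ (a + (-1) ^+ b * c + (3 * (b * d))%:R : 'Z_6)%R
       + g *+ (b + d : 'Z_2)%R))%R; last first.
  by rewrite -[in RHS](dic_charE t4 (a, b)).
rewrite [in lam _ _]/dic_recog (lamD _ (e *+ y)%R) (lamD _ (z *+ c)%R) !lamMn.
rewrite lame lamz lamg.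
have val_tX n : val (t ^+ n)%g = ((s ^ n)%N%:R)%R :> 'Z_p.
  by rewrite natrX -t_s FinRing.val_unitX.
rewrite /dic_recog val_tX (mulrn_ZpD p_gt1 pe) (mulrn_ZpM p_gt1 pe).
rewrite (mulrn_Zp_nat p_gt1 pe).
rewrite !(mulrn_ZpD _ z6) // (mulrn_ZpM _ z6) // (mulrn_Zp_nat _ z6) //.
rewrite (mulrn_ZpD _ g2) //.
rewrite mulrnDl -!mulrnA -[(3 * b * d)%N]mulnA.
rewrite /= [RHS]addrACA; congr (_ + _)%R.
by rewrite [RHS]addrACA -[LHS]addrA; congr (_ + _)%R; rewrite addrC -addrA.
Qed.

Lemma dic_recog_iso :
  (forall u, dic_recog u = 0%R -> u = 0%R) -> #|B| = (p * 12)%N ->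
  brace_iso B (dic_model t4).
Proof.
move=> ker0 cB; apply: brace_iso_sym; exists dic_recog.
split; [ | exact: dic_recogD | exact: dic_recogM].
apply: inj_card_bij; last first.
  by rewrite cB card_prod card_ord Zp_cast // [#|_|]card_dicBrace.
move=> u v eq_uv; apply/eqP; rewrite -subr_eq0; apply/eqP/ker0.
by apply: (addIr (dic_recog v)); rewrite -dic_recogD subrK add0r.
Qed.

End Recognition.

(** * Coordinates of the torsion subgroups *)

(** A group with the presentation of Dic12 and with 12 elements is isomorphic
    to dicBrace; #|F| = 12 comes from comparing the orders of B and
    Z_p ><| F. *)
Lemma dic_quotient p (B : finLeftBraceType) :
  1 < p -> #|B| = (p * 12)%N -> multiplicative_group_Zp_Dic12 p B ->
  exists pi : {morphism [set: B] >-> dicBrace}, #|'ker pi| = p.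
Proof.
move=> p_gt1 cB [F [tau [dicF isoB]]].
have cF : #|[set: F]| = #|[set: dicBrace]|.
  move/card_isog/eqP: isoB; rewrite !cardsT cB card_prod card_ord Zp_cast //.
  by rewrite eqn_pmul2l ?(ltnW p_gt1) // card_dicBrace => /eqP.
have /isogP[phi _ im_phi] : [set: F] \isog [set: dicBrace].
  by apply/(isoGrpP _ dic_is_Dic12); split; last exact: isoGrp_hom.
have /isogP[h _ im_h] := isoB.
have piM : {in [set: B] &, {morph (fun u => phi (h u).2) : u v / u * v}}.
  by move=> u v _ _; rewrite /= morphM ?inE //= -[RHS]morphM ?inE.
exists (Morphism piM); apply/eqP.
rewrite -(eqn_pmul2r (isT : 0 < 12)) -cB -card_dicBrace.
rewrite -[#|{: dicBrace}|]cardsT -[#|B|]cardsT.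
have <- : Morphism piM @* [set: B] = [set: dicBrace].
  apply/setP=> q; rewrite morphimEdom inE; apply/imsetP.
  have /morphimP[b _ _ ->] : q \in phi @* [set: F] by rewrite im_phi inE.
  have /morphimP[u _ _ hu] : (0%R, b) \in h @* [set: B] by rewrite im_h inE.
  by exists u; rewrite ?inE //= -hu.
by rewrite card_morphim setTI Lagrange ?subsetT.
Qed.

(** Through an additive isomorphism f with Z_p x (Z_6 x Z_2), the p-torsion is
    the first factor, and the n-torsion for n dividing 12 lies in the second. *)
Section Coordinates.

Variables (p : nat) (B : finLeftBraceType).
Variables (f : {additive B -> ('Z_p * ('Z_6 * 'Z_2))%type}).
Variables (g : 'Z_p * ('Z_6 * 'Z_2) -> B).
Hypotheses (p_gt1 : 1 < p) (co_p : coprime p 12).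
Hypotheses (fK : cancel f g) (gK : cancel g f).

Lemma card_coord : #|B| = (p * 12)%N.
Proof.
rewrite (bij_eq_card (Bijective fK gK)) card_prod card_ord Zp_cast //.
by rewrite [#|_|]card_dicBrace.
Qed.

Definition dic_coord (b : B) : dicBrace := (f b).2.

Lemma dic_coordMn b n : dic_coord (b *+ n)%R = (dic_coord b *+ n)%R.
Proof. by rewrite /dic_coord raddfMn pair_mulrn. Qed.

Lemma torsion12_coord b : b \in torsion B 12 -> (f b).1 = 0%R.
Proof.
move/torsionP/(congr1 f); rewrite raddf0 raddfMn pair_mulrn.
move/(congr1 fst) => /= fb.
by apply: mulrn_coprime fb (mulrn_Zp _ p_gt1); rewrite coprime_sym.
Qed.

Lemma dic_coord_inj : {in torsion B 12 &, injective dic_coord}.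
Proof.
move=> a b /torsion12_coord a0 /torsion12_coord b0 eq_ab.
apply: (can_inj fK); rewrite [f a]surjective_pairing [f b]surjective_pairing.
by rewrite a0 b0; congr pair.
Qed.

Lemma mem_torsion_dic n q : (q *+ n = 0 :> dicBrace)%R ->
  g (0%R, q) \in torsion B n.
Proof.
move=> qn; apply/torsionP; apply: (can_inj fK).
by rewrite raddfMn raddf0 gK pair_mulrn /= mul0rn [X in (_, X)]qn.
Qed.

Lemma card_torsion12 n : n %| 12 ->
  #|torsion B n| = count (fun q : dicBrace => q *+ n == 0)%R dic_seq.
Proof.
move=> n12; rewrite -card_dic_pred.
have sub12 := subsetP (torsion_dvd B n12).
rewrite -(card_in_imset (f := dic_coord) (D := mem (torsion B n))); last first.
  by move=> a b /sub12 a12 /sub12 b12; apply: dic_coord_inj.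
congr #|pred_of_set _|; apply/setP=> q; rewrite inE; apply/imsetP/eqP.
  by case=> b /torsionP nb ->; rewrite -dic_coordMn nb /dic_coord raddf0.
by move=> qn; exists (g (0%R, q)); rewrite ?mem_torsion_dic // /dic_coord gK.
Qed.

Lemma torsionp_coord b : b \in torsion B p -> (f b).2 = 0%R.
Proof.
move/torsionP/(congr1 f); rewrite raddf0 raddfMn pair_mulrn.
move/(congr1 snd) => /= fb.
apply: (mulrn_coprime co_p fb).
by have := mulrn_card ((f b).2 : dicBrace); rewrite [#|_|]card_dicBrace.
Qed.

Lemma card_torsionp : #|torsion B p| = p.
Proof.
have -> : torsion B p = [set g (x, 0%R) | x : 'Z_p].
  apply/setP=> b; apply/idP/imsetP => [pb | [x _ ->]].
    exists (f b).1 => //; apply: (can_inj fK).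
    by rewrite gK [LHS]surjective_pairing torsionp_coord.
  apply/torsionP; apply: (can_inj fK).
  by rewrite raddfMn raddf0 gK pair_mulrn /= mul0rn mulrn_Zp.
rewrite card_imset ?card_ord ?Zp_cast // => x y /(can_inj gK).
by move=> /(congr1 fst).
Qed.

Lemma torsionp_gen b : b \in torsion B p -> exists n, b = (g (1%R, 0%R) *+ n)%R.
Proof.
move=> pb; exists (f b).1; apply: (can_inj fK); rewrite raddfMn gK pair_mulrn.
by rewrite mul0rn natr_Zp [LHS]surjective_pairing torsionp_coord.
Qed.

Lemma torsionp_gen_order n : (g (1%R, 0%R) *+ n = 0)%R -> p %| n.
Proof.
move/(congr1 f); rewrite raddfMn gK raddf0 pair_mulrn => /(congr1 fst) /=.
by move/(congr1 val); rewrite /= val_Zp_nat // => /eqP.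
Qed.

End Coordinates.

(** * Classification *)

Section Structure.

Variables (p : nat) (B : finLeftBraceType).
Variables (f : {additive B -> ('Z_p * ('Z_6 * 'Z_2))%type}).
Variables (f' : 'Z_p * ('Z_6 * 'Z_2) -> B).
Variable pi : {morphism [set: B] >-> dicBrace}.
Hypotheses (p_prime : prime p) (co_p : coprime p 12).
Hypotheses (fK : cancel f f') (f'K : cancel f' f) (card_ker : #|'ker pi| = p).

Let p_gt1 : 1 < p := prime_gt1 p_prime.
Local Notation coord := (dic_coord f).

Lemma coordD : {morph coord : a b / (a + b)%R}.
Proof. by move=> a b; rewrite /dic_coord raddfD. Qed.

Lemma coord0 : coord 0%R = 0%R. Proof. by rewrite /dic_coord raddf0. Qed.

Lemma coordN : {morph coord : a / (- a)%R}.
Proof. by move=> a; rewrite /dic_coord raddfN. Qed.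

Lemma piM : {morph pi : a b / a * b}.
Proof. by move=> a b; rewrite morphM ?inE. Qed.

Lemma piX n : {morph pi : a / a ^+ n}.
Proof. by move=> a; rewrite morphX ?inE. Qed.

Lemma piJ : {morph pi : a b / a ^ b}.
Proof. by move=> a b; rewrite morphJ ?inE. Qed.

Lemma expg_torsion2 b : b \in torsion B 2 -> b ^+ 4 = 1.
Proof.
by move/torsion_expg_card; rewrite (card_torsion12 p_gt1 co_p fK f'K).
Qed.

Lemma expg_torsion3 b : b \in torsion B 3 -> b ^+ 3 = 1.
Proof.
by move/torsion_expg_card; rewrite (card_torsion12 p_gt1 co_p fK f'K).
Qed.

(** The two subgroups have order p, and pi kills elements of order p since
    Dic12 has order 12. *)
Lemma torsionp_ker : torsion B p = 'ker pi.
Proof.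
have card_p := card_torsionp p_gt1 co_p fK f'K.
apply/eqP; rewrite eqEcard card_ker card_p leqnn andbT.
apply/subsetP=> b /torsion_expg_card; rewrite card_p => bp.
apply/kerP; rewrite ?inE //; apply/eqP; rewrite -order_eq1 -dvdn1 -(eqP co_p).
rewrite dvdn_gcd; apply/andP; split; rewrite order_dvdn.
  by rewrite -piX bp morph1.
by rewrite -[X in _ ^+ X]card_dicBrace -cardsT expg_cardG ?inE.
Qed.

Lemma mem_torsionp b : (b \in torsion B p) = (pi b == 1).
Proof. by rewrite torsionp_ker; apply/(kerP pi (in_setT b))/eqP. Qed.

(** The quotient of two elements of T_n with the same image is in T_n and in
    the kernel T_p. *)
Lemma pi_inj n : coprime p n -> {in torsion B n &, injective pi}.
Proof.
move=> co_pn a b na nb eq_pi; apply/eqP; rewrite eq_mulgV1 (brace1E B).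
apply/eqP/(torsion_coprime co_pn); last by rewrite groupM ?groupV.
by rewrite mem_torsionp piM morphV ?inE // eq_pi mulgV.
Qed.

Lemma coord_inj : {in torsion B 12 &, injective coord}.
Proof. exact: dic_coord_inj p_gt1 co_p fK. Qed.

Lemma torsion2P a b c :
  a \in torsion B 2 -> b \in torsion B 2 -> c \in torsion B 2 ->
  (a != 0 -> b != 0 -> a != b -> c \in [:: 0; a; b; a + b])%R.
Proof.
move=> a2 b2 c2 a0 b0 ab.
have sub12 := subsetP (torsion_dvd B (isT : 2 %| 12)).
have coord2 d : d \in torsion B 2 -> (coord d *+ 2 = 0)%R.
  by move/torsionP=> d2; rewrite -dic_coordMn d2 coord0.
have z2 : 0%R \in torsion B 2 by apply/torsionP; rewrite mul0rn.
have inj2 : {in torsion B 2 &, injective coord}.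
  by move=> u v /sub12 ? /sub12 ?; apply: coord_inj.
have neq2 u v : u \in torsion B 2 -> v \in torsion B 2 ->
    u != v -> coord u != coord v.
  by move=> u2 v2; apply: contra_neq; apply: inj2.
have := dic_add2 (coord2 _ a2) (coord2 _ b2) (coord2 _ c2).
rewrite -coord0 !neq2 // -coordD => /(_ isT isT isT).
by rewrite !inE => /or4P[] /eqP /inj2->; rewrite ?eqxx ?orbT // torsionD.
Qed.

Lemma torsion3P a b : a \in torsion B 3 -> b \in torsion B 3 ->
  (a != 0 -> b \in [:: 0; a; - a])%R.
Proof.
move=> a3 b3 a0.
have sub12 := subsetP (torsion_dvd B (isT : 3 %| 12)).
have coord3 d : d \in torsion B 3 -> (coord d *+ 3 = 0)%R.
  by move/torsionP=> d3; rewrite -dic_coordMn d3 coord0.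
have z3 : 0%R \in torsion B 3 by apply/torsionP; rewrite mul0rn.
have inj3 : {in torsion B 3 &, injective coord}.
  by move=> u v /sub12 ? /sub12 ?; apply: coord_inj.
have ca0 : coord a != 0%R by rewrite -coord0; apply: contra_neq a0; apply: inj3.
have := dic_add3 (coord3 _ a3) (coord3 _ b3) ca0.
rewrite !inE -coord0 -coordN.
by case/or3P=> /eqP /inj3->; rewrite ?eqxx ?orbT // torsionN.
Qed.

(** T_p is normal in the multiplicative group, as the kernel of pi. *)
Lemma torsionp_fix a b : a \in torsion B p -> b \in torsion B 12 -> lam a b = b.
Proof.
move=> pa b12; apply: (lam_coprime_fix co_p pa) => //.
rewrite mem_torsionp piJ -(conj1g (pi b)) (inj_eq (conjg_inj _)).
by rewrite -mem_torsionp.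
Qed.

Local Notation e := (f' (1%R, 0%R)).

Lemma mem_e : e \in torsion B p.
Proof.
apply/torsionP/(can_inj fK).
by rewrite raddfMn raddf0 f'K pair_mulrn /= mul0rn mulrn_Zp.
Qed.

Lemma lam_e a : exists s, lam a e = (e *+ s)%R.
Proof. exact/(torsionp_gen co_p fK f'K)/lam_torsion/mem_e. Qed.

Lemma e_mod n : (e *+ (n %% p) = e *+ n)%R.
Proof. by apply: mulrn_mod; apply/torsionP/mem_e. Qed.

(** On T_p, lambda_e is a scaling by some s; e^p = 1 gives s^p = 1, that is
    s = 1 modulo p by Fermat's little theorem. *)
Lemma lam_e_e : lam e e = e.
Proof.
have [s es] := lam_e e.
have ep : e ^+ p = 1.
  rewrite -[X in _ ^+ X](card_torsionp p_gt1 co_p fK f'K).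
  by rewrite torsion_expg_card ?mem_e.
have := lam_scaleX p es; rewrite ep lam1 -e_mod (fermat_little _ p_prime) e_mod.
by rewrite es.
Qed.

(** Otherwise lambda_m(m) = - m, and m^2 = 0 = 1 while m^3 = 1. *)
Lemma lam_torsion3_self m : m \in torsion B 3 -> lam m m = m.
Proof.
move=> m3; have [-> | m0] := eqVneq m 0%R; first exact: lam0.
have := torsion3P m3 (lam_torsion m m3) m0.
rewrite !inE => /or3P[] /eqP // lam_m.
  by case/eqP: m0; apply: (@lam_inj _ m); rewrite lam_m lam0.
have m2 : m ^+ 2 = 1 by rewrite expgS expg1 mulgE_lam lam_m subrr -brace1E.
by case/eqP: m0; rewrite -(brace1E B) -(expg_torsion3 m3) expgS m2 mulg1.
Qed.

(** The image of m^b under pi is a power of that of m, since the Sylow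
    3-subgroup of Dic12 is normal; hence m^b is in T_3 T_p, which lies in
    T_(3p), and 3p is prime to 2. *)
Lemma torsion3_fix_torsion2 m b :
  m \in torsion B 3 -> b \in torsion B 2 -> lam m b = b.
Proof.
move=> m3 b2.
have co3p2 : coprime (3 * p) 2.
  by rewrite coprimeMl /=; move: co_p; rewrite (coprimeMr p 2 6) => /andP[].
have sub3 : torsion B 3 \subset torsion B (3 * p).
  by rewrite torsion_dvd ?dvdn_mulr.
have subp : torsion B p \subset torsion B (3 * p).
  by rewrite torsion_dvd ?dvdn_mull.
apply: (lam_coprime_fix co3p2 (subsetP sub3 _ m3)) => //.
have [n pi_n] : exists n, pi (m ^ b) = pi (m ^+ n).
  have : pi m ^+ 3 = 1 by rewrite -piX (expg_torsion3 m3) morph1.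
  case/(@dic_conj3 _ (pi b)) => E; [exists 1%N | exists 2].
    by rewrite piJ piX E.
  by rewrite piJ piX E.
rewrite -[m ^ b](mulKVg (m ^+ n)) groupM //.
  by rewrite groupX // (subsetP sub3).
apply: (subsetP subp); rewrite mem_torsionp piM morphV ?inE // pi_n.
by rewrite mulVg.
Qed.

(** Two distinct involutions of T_2 would have the same image under pi, namely
    the unique involution of Dic12. *)
Lemma torsion2_order4 : exists2 g, g \in torsion B 2 & g ^+ 2 != 1.
Proof.
pose v1 := f' (0, (3%:R, 0))%R; pose v2 := f' (0, (0, 1))%R.
have v1_2 : v1 \in torsion B 2 by apply: (mem_torsion_dic fK f'K); apply/eqP.
have v2_2 : v2 \in torsion B 2 by apply: (mem_torsion_dic fK f'K); apply/eqP.
have [v1s | ] := eqVneq (v1 ^+ 2) 1; last by exists v1.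
have [v2s | ] := eqVneq (v2 ^+ 2) 1; last by exists v2.
have co_p2 : coprime p 2 by move: co_p; rewrite (coprimeMr p 2 6) => /andP[].
have pi_v v : v \in torsion B 2 -> v ^+ 2 = 1 -> v != 1 -> pi v = (3%:R, 0)%R.
  move=> v_2 vs v_n1; apply: dic_involution; first by rewrite -piX vs morph1.
  by rewrite -(morph1 pi); apply: contra_neq v_n1 => /(pi_inj co_p2)->.
have v1_n1 : v1 != 1.
  rewrite (brace1E B); apply/eqP=> /(congr1 f); rewrite f'K raddf0.
  by move/(congr1 (fun u => u.2.1)).
have v2_n1 : v2 != 1.
  rewrite (brace1E B); apply/eqP=> /(congr1 f); rewrite f'K raddf0.
  by move/(congr1 (fun u => u.2.2)).
have /(can_inj f'K)/(congr1 (fun u => u.2.1)) // : v1 = v2.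
by apply: (pi_inj co_p2) => //; rewrite !pi_v.
Qed.

(** The value of lambda_g(g) comes from g^2 = g + lambda_g(g) and 2g = 0.  As
    g^4 = 1, the square k of g satisfies k + lambda_k(k) = 0, so lambda_k fixes
    k; since lambda_k is the square of lambda_g, this excludes lambda_g(k) = g,
    the only value other than k that injectivity of lambda_g allows. *)
Lemma torsion2_square g : g \in torsion B 2 -> g ^+ 2 != 1 ->
  [/\ g ^+ 2 \in torsion B 2, lam g g = (g + (g ^+ 2)%g)%R &
      lam g (g ^+ 2) = g ^+ 2].
Proof.
set k := g ^+ 2; move=> g2 k_n1; have k2 : k \in torsion B 2 by apply: groupX.
have dbl v : v \in torsion B 2 -> (v + v = 0)%R.
  by move/torsionP; rewrite mulr2n.
have kE : k = (g + lam g g)%R by rewrite -mulgE_lam.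
have lam_gg : lam g g = (g + k)%R by rewrite kE addrA dbl // add0r.
have k0 : (k != 0)%R by rewrite -(brace1E B).
have g0 : (g != 0)%R.
  by apply: contra_neq k_n1 => g_0; rewrite /k g_0 -(brace1E B) expg1n.
have gk : g != k.
  apply: contra_neq g0 => gk; apply: (@lam_inj _ g).
  by rewrite lam0 lam_gg -gk dbl.
have lam_kk : lam k k = k.
  have : k * k = 0%R by rewrite -expgD (expg_torsion2 g2) brace1E.
  by rewrite mulgE_lam -(dbl _ k2) => /addrI.
split=> //; have := torsion2P g2 k2 (lam_torsion g k2) g0 k0 gk.
rewrite !inE => /or4P[] /eqP // lam_gk.
- by case/eqP: k0; apply: (@lam_inj _ g); rewrite lam_gk lam0.
- move: lam_kk; rewrite [in lam k]/k expgS expg1 lamM lam_gk lam_gg.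
  by rewrite -[RHS]add0r => /addIr g_0; rewrite g_0 eqxx in g0.
by case/eqP: gk; apply: (@lam_inj _ g); rewrite lam_gk.
Qed.

(** If lambda_g fixed m, then g and m would commute, since lambda_m fixes g. *)
Lemma torsion2_inverts g m : g \in torsion B 2 -> g ^+ 2 != 1 ->
  m \in torsion B 3 -> lam g m = (- m)%R.
Proof.
move=> g2 g_n1 m3; have [-> | m0] := eqVneq m 0%R; first by rewrite lam0 oppr0.
have := torsion3P m3 (lam_torsion g m3) m0.
rewrite !inE => /or3P[] /eqP // lam_gm.
  by case/eqP: m0; apply: (@lam_inj _ g); rewrite lam_gm lam0.
have co_p2 : coprime p 2 by move: co_p; rewrite (coprimeMr p 2 6) => /andP[].
have co_p3 : coprime p 3 by move: co_p; rewrite (coprimeMr p 3 4) => /andP[].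
have comm_gm : g * m = m * g.
  by rewrite !mulgE_lam lam_gm (torsion3_fix_torsion2 m3 g2) addrC.
have pi_m : pi m = 1.
  apply: (@dic_no_commute (pi g)).
  - rewrite -piX -(morph1 pi); apply: contra_neq g_n1.
    by apply: (pi_inj co_p2) => //; rewrite groupX.
  - by rewrite -piX (expg_torsion2 g2) morph1.
  - by rewrite -piX (expg_torsion3 m3) morph1.
  by rewrite -!piM comm_gm.
case/eqP: m0; rewrite -(brace1E B).
by apply: (pi_inj co_p3) => //; rewrite morph1.
Qed.

(** The relation g m = m^2 g is obtained from the additive description of both
    sides; since scalings of T_p commute, it makes lambda_m and its square agree
    on e. *)
Lemma torsion3_fix_e m : m \in torsion B 3 -> lam m e = e.
Proof.
move=> m3; have [g g2 g_n1] := torsion2_order4.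
have lam_gm := torsion2_inverts g2 g_n1 m3.
have gm : g * m = m * m * g.
  have mm : (m * m) = (- m)%R.
    rewrite mulgE_lam (lam_torsion3_self m3); apply: (addIr m).
    by rewrite addNr -mulr2n -mulrSr; apply/torsionP.
  rewrite mulgE_lam lam_gm (mulgE_lam (m * m)).
  by rewrite lamM !(torsion3_fix_torsion2 m3 g2) mm addrC.
have [[s ms] [t gt]] := (lam_e m, lam_e g).
(* Both sides act on the cyclic group of order p, where scalings commute. *)
have := congr1 (fun u => lam u e) gm.
rewrite !lamM gt ms !lamMn ms !lamMn ms gt -!mulrnA => eq_ts.
apply/(@lam_inj _ m)/(@lam_inj _ g).
rewrite ms !lamMn ms !lamMn gt -!mulrnA eq_ts.
by rewrite [(t * _)%N]mulnC -[(s * s * t)%N]mulnA.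
Qed.

(** With z = m + k, all the values required by dic_recog_iso follow from
    lambda_z = lambda_m lambda_g^2.  Injectivity of the resulting map is checked
    on the p-, 3- and 2-torsion components in turn. *)
Lemma dic_model_classification :
  exists (t : {unit 'Z_p}) (t4 : t ^+ 4 = 1), brace_iso B (dic_model t4).
Proof.
have [g g2 g_n1] := torsion2_order4.
have [] := torsion2_square g2 g_n1; set k := g ^+ 2 => k2 lam_gg lam_gk.
pose m := f' (0, (2%:R, 0))%R.
have m3 : m \in torsion B 3 by apply: (mem_torsion_dic fK f'K); apply/eqP.
have m0 : m != 0%R.
  by apply/eqP=> /(congr1 f); rewrite f'K raddf0 => /(congr1 (fun u => u.2.1)).
have k0 : (k != 0)%R by rewrite -(brace1E B).
have g0 : (g != 0)%R.
  by apply: contra_neq g_n1 => g_0; rewrite g_0 -(brace1E B) expg1n.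
have gk : (g + k != 0)%R.
  by rewrite -lam_gg -(lam0 g) (inj_eq (@lam_inj _ _)).
have dbl v : v \in torsion B 2 -> (v + v = 0)%R.
  by move/torsionP; rewrite mulr2n.
have lam_gm := torsion2_inverts g2 g_n1 m3.
have [s lam_ge] := lam_e g.
have lam_k b : lam k b = lam g (lam g b) by rewrite /k expgS expg1 lamM.
have lam_m2 := torsion3_fix_torsion2 m3.
pose z := (m + k)%R.
have zE : z = m * k by rewrite lam_fix_mul ?lam_m2.
have s4 : ((s%:R : 'Z_p) ^+ 4 = 1)%R.
  have := lam_scaleX 4 lam_ge; rewrite (expg_torsion2 g2) lam1.
  move/(congr1 f)/(congr1 fst); rewrite raddfMn f'K pair_mulrn /= => E.
  by rewrite -natrX -E.
have Us : (s%:R : 'Z_p)%R \is a GRing.unit.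
  by apply/unitrP; exists ((s%:R) ^+ 3)%R; rewrite -exprS -exprSr s4.
pose t : {unit 'Z_p} := FinRing.Unit Us.
have t4 : t ^+ 4 = 1.
  by apply: val_inj; rewrite -[RHS]s4 FinRing.val_unitX.
exists t, t4.
have sub12 n v : n %| 12 -> v \in torsion B n -> v \in torsion B 12.
  by move=> n12; apply/subsetP/torsion_dvd.
have z12 : z \in torsion B 12.
  by rewrite torsionD ?(sub12 3 _ _ m3) ?(sub12 2 _ _ k2).
have lam_z v : lam z v = lam m (lam g (lam g v)) by rewrite zE lamM lam_k.
have lam_kg : lam g (g + k)%R = g.
  by rewrite lamD lam_gk lam_gg -addrA dbl ?addr0.
have lam_gz : lam g z = (- z)%R.
  rewrite /z lamD lam_gm lam_gk opprD; congr (_ + _)%R.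
  by apply: (addIr k); rewrite addNr dbl.
have lam_mz : lam m z = z by rewrite /z lamD (lam_torsion3_self m3) lam_m2.
have z3 : (z *+ 3 = k)%R.
  by rewrite mulrnDl (torsionP _ _ m3) add0r mulrSr mulr2n dbl ?add0r.
apply: (dic_recog_iso (e := e) (z := z) (g := g) (s := s)) => //.
- exact/torsionP/mem_e.
- by rewrite (mulrnA z 3 2) z3; apply/torsionP.
- exact/torsionP.
- exact: lam_e_e.
- by apply: torsionp_fix mem_e _.
- by apply: torsionp_fix mem_e _; apply: sub12 g2.
- by rewrite lam_z lam_ge lamMn lam_ge lamMn lamMn torsion3_fix_e // mulrnA.
- by rewrite lam_z lam_gz lamN lam_gz opprK.
- by rewrite lam_z lam_gg lam_kg lam_m2.
- by rewrite lam_gg z3.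
- move=> [x [a b]]; rewrite /dic_recog /= => xab0.
  have p_ex : (e *+ x)%R \in torsion B p by rewrite torsion_mulrn ?mem_e.
  have y12 : (z *+ a + g *+ b)%R \in torsion B 12.
    by rewrite torsionD // torsion_mulrn // (sub12 2 _ _ g2).
  have ex0 : (e *+ x = 0)%R.
    apply: torsion_coprime co_p p_ex _ => //.
    by move/eqP: xab0; rewrite addr_eq0 => /eqP->; rewrite torsionN.
  have x0 : x = 0%R.
    apply: val_inj; apply/eqP; have := torsionp_gen_order p_gt1 f'K ex0.
    by rewrite /dvdn modn_small // -[X in _ < X](Zp_cast p_gt1) ltn_ord.
  move: xab0; rewrite ex0 add0r => zg0.
  have zaN : (z *+ a = m *+ a + k *+ a)%R by rewrite mulrnDl.
  have ma0 : (m *+ a = 0)%R.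
    apply: (torsion_coprime (isT : coprime 3 2)); first exact: torsion_mulrn.
    move/eqP: zg0; rewrite zaN -addrA addr_eq0 => /eqP->.
    by rewrite torsionN // torsionD // torsion_mulrn.
  move: zg0; rewrite zaN ma0 add0r => kg0.
  have a3 : 3 %| a.
    apply: contraNT m0; rewrite -prime_coprime // coprime_sym => co_a.
    by apply/eqP/(mulrn_coprime co_a ma0)/torsionP.
  move: kg0; rewrite x0; case/dvdnP: a3 => c ac; rewrite ac mulnC mulrnA.
  have k3 : (k *+ 3 = k)%R by rewrite mulrSr mulr2n dbl ?add0r.
  rewrite k3; have: c < 2 by rewrite -(ltn_pmul2r (isT : 0 < 3)) -ac ltn_ord.
  elim/Z2P: b {y12} => /=; case: c ac => [|[|//]] ac _ kg0.
  + by congr (_, (_, _)); apply: val_inj; rewrite /= ac.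
  + by case/eqP: k0; rewrite -[RHS]kg0 addr0.
  + by case/eqP: g0; rewrite -[RHS]kg0 add0r.
  by case/eqP: gk; rewrite -[RHS]kg0 addrC.
exact: card_coord p_gt1 fK f'K.
Qed.

End Structure.

(** * Counting the braces *)

Lemma card_units_prime p : prime p -> #|units_Zp p| = p.-1.
Proof.
move=> p_prime; rewrite card_units_Zp ?prime_gt0 //.
by rewrite (totient_pfactor p_prime (isT : 0 < 1)) expn0 muln1.
Qed.

Lemma units_Zp_order p d :
  prime p -> d %| p.-1 -> exists t : {unit 'Z_p}, #[t] = d.
Proof.
move=> p_prime d_p; have /cyclicP[u def_u] := units_Zp_cyclic p_prime.
have p1_gt0 : 0 < p.-1 by rewrite -ltnS prednK ?prime_gt0 ?prime_gt1.
have ou : #[u] = p.-1 by rewrite /order -def_u card_units_prime.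
by exists (u ^+ (p.-1 %/ d)); rewrite orderXdiv ou ?divnA ?mulKn ?dvdn_div.
Qed.

(** The representative of index i is the model of a unit of order 2^i; the
    number n of representatives is that of the divisors of 4 dividing p - 1. *)
Lemma dic_model_representatives p n :
  prime p -> coprime p 12 ->
  (forall k, k <= 2 -> (2 ^ k %| p.-1) = (k < n)) -> n <= 3 ->
  exists B : 'I_n -> finLeftBraceType,
    [/\ iso_representatives (fun B0 => additive_group_ZpxC6xC2 p B0 /\
                                       multiplicative_group_Zp_Dic12 p B0) B,
        forall i : 'I_n, i = 0 :> nat -> is_direct_product p (B i) &
        forall i : 'I_n, has_kernel_of_order p (12 %/ 2 ^ i) (B i)].
Proof.
move=> p_prime co_p pow2 n_le3; have p_gt1 := prime_gt1 p_prime.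
have /fin_all_exists[t ot] (i : 'I_n) :
    exists t : {unit 'Z_p}, #[t] = (2 ^ i)%N.
  apply: units_Zp_order => //.
  by rewrite pow2 // -ltnS (leq_trans (ltn_ord i)).
have t4 i : t i ^+ 4 = 1.
  apply/eqP; rewrite -order_dvdn ot; apply: (@dvdn_exp2l 2 i 2).
  by rewrite -ltnS (leq_trans (ltn_ord i)).
exists (fun i => dic_model (t4 i)); split; last 2 first.
- move=> i i0; have t1 : t i = 1 by apply/eqP; rewrite -order_eq1 ot i0.
  by move: (t4 i); rewrite t1 => t14; apply: dic_model_direct.
- by move=> i; rewrite -ot; apply: dic_model_kernel.
split=> [i | i j | B0 [[f [g fK gK]] multB0]].
- by split; [apply: dic_model_additive | apply: dic_model_multiplicative].
- move/(dic_model_iso _ _ p_prime co_p); rewrite !ot => /eqP.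
  by rewrite eqn_exp2l // => /eqP/val_inj.
have [pi card_ker] := dic_quotient p_gt1 (card_coord p_gt1 fK gK) multB0.
have [s [s4 isoB0]] := dic_model_classification p_prime co_p fK gK card_ker.
have /(dvdn_pfactor _ 2 (isT : prime 2))[k k_le2 os] : #[s] %| 2 ^ 2.
  by rewrite order_dvdn s4.
have k_lt_n : k < n.
  by rewrite -pow2 // -os -(card_units_prime p_prime) order_dvdG ?inE.
exists (Ordinal k_lt_n); apply: brace_iso_trans isoB0 _.
by apply/dic_model_iso; rewrite ?os ?ot.
Qed.

Theorem proposition19 (p : nat) (p_prime : prime p) (p_ge7 : 7 <= p) :
  let P (B : finLeftBraceType) :=
    additive_group_ZpxC6xC2 p B /\ multiplicative_group_Zp_Dic12 p B in
  (p <> 1 %[mod 4] ->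
   exists B : 'I_2 -> finLeftBraceType,
     [/\ iso_representatives P B,
         is_direct_product p (B 0%R) &
         has_kernel_of_order p 6 (B 1%R)]) /\
  (p = 1 %[mod 4] ->
   exists B : 'I_3 -> finLeftBraceType,
     [/\ iso_representatives P B,
         is_direct_product p (B 0%R),
         has_kernel_of_order p 6 (B 1%R) &
         has_kernel_of_order p 3 (B 2%R)]).
Proof.
move=> P; have p_gt1 := prime_gt1 p_prime.
have co_p : coprime p 12.
  rewrite prime_coprime //; apply: contraL p_ge7 => p12.
  have: p \in divisors 12 by rewrite -dvdn_divisors.
  by rewrite !inE => /or4P[||| /or3P[]] /eqP p_eq; rewrite p_eq // in p_prime *.
have odd_p : odd p.
  by move: co_p; rewrite (coprimeMr p 2 6) coprimen2 => /andP[].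
have pow1 : 2 ^ 1 %| p.-1.
  by rewrite dvdn2 -subn1 oddB ?odd_p ?(ltnW p_gt1).
have pow2 : (2 ^ 2 %| p.-1) = (p == 1 %[mod 4]).
  by rewrite eqn_mod_dvd ?subn1 // ltnW.
split=> p_mod.
  have [|B [repB dirB kerB]] :=
      @dic_model_representatives p 2 p_prime co_p _ isT.
    case=> [|[|[|//]]] _; rewrite ?dvd1n ?pow1 // pow2.
    exact/negbTE/eqP.
  by exists B; split=> //; [exact: dirB | exact: kerB 1%R].
have [|B [repB dirB kerB]] :=
    @dic_model_representatives p 3 p_prime co_p _ isT.
  case=> [|[|[|//]]] _; rewrite ?dvd1n ?pow1 // pow2.
  exact/eqP.
by exists B; split=> //; [exact: dirB | exact: kerB 1%R | exact: kerB 2%R].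
Qed.
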